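(* Suppose that we have a $k$-th order system of two rational difference equations $$x_n=\frac{\alpha+\sum^{k}_{i=1}\beta_{i}x_{n-i} + \sum^{k}_{i=1}\gamma_{i}y_{n-i}}{A+\sum^{k}_{j=1}B_{j}x_{n-j} + \sum^{k}_{j=1}C_{j}y_{n-j}},\qquad y_n=\frac{p+\sum^{k}_{i=1}\delta_{i}x_{n-i} + \sum^{k}_{i=1}\epsilon_{i}y_{n-i}}{q+\sum^{k}_{j=1}D_{j}x_{n-j} + \sum^{k}_{j=1}E_{j}y_{n-j}},\qquad n\in\mathbb{N},$$ with non-negative parameters and non-negative initial conditions. Also suppose that $\{y_n\}_{n=1}^\infty$ is bounded above and below, that $I_C\neq\emptyset$, and that there exists a positive integer $\eta$ such that for every sequence $\{c_m\}_{m=1}^\infty$ with $c_m\in I_\beta$ for $m=1,2,\dots$ there exist positive integers $N_1,N_2\le\eta$ such that $\sum_{m=N_1}^{N_2}c_m\in I_B$. Then there exist $M>0$ and $N\in\mathbb{N}$ so that, given any non-negative initial conditions, we have $x_n\le M$ for all $n>N$.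
   Context: $\mathbb{N}=\{1,2,\dots\}$ and $k$ is a positive integer. Initial conditions are $x_{1-k},\dots,x_0,y_{1-k},\dots,y_0\ge 0$, taken so that the denominators do not vanish. Index sets in $\{1,\dots,k\}$: $I_\beta=\{i:\beta_i>0\}$, $I_B=\{j:B_j>0\}$, $I_C=\{j:C_j>0\}$. Since $y_n\ge 0$ automatically, ''bounded below'' means bounded below by a positive constant. *)

(* Defs.v *)
From HB Require Import structures.
From mathcomp Require Import all_boot all_order all_algebra.
From mathcomp Require Import reals.

Set Implicit Arguments.
Unset Strict Implicit.
Unset Printing Implicit Defensive.

Import Order.TTheory GRing.Theory Num.Theory.
Local Open Scope ring_scope.

(* Coefficient families are functions on nat of which only the
   values at 1, ..., k are ever used; sequences are functions on int of which
   only the values at indices >= 1 - k are ever used. *)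

Definition affine_form (R : realType) (k : nat) (a : R) (b c : nat -> R)
    (x y : int -> R) (n : int) : R :=
  a + \sum_(1 <= i < k.+1) b i * x (n - i%:Z)
    + \sum_(1 <= i < k.+1) c i * y (n - i%:Z).

Definition nonneg_coefs (R : realType) (k : nat) (a : R) (b c : nat -> R) : Prop :=
  0 <= a /\ forall i : nat, (1 <= i <= k)%N -> 0 <= b i /\ 0 <= c i.

Definition pos_index (R : realType) (k : nat) (b : nat -> R) : pred nat :=
  [pred i : nat | (1 <= i <= k)%N && (0 < b i)].

(* The non-vanishing of every denominator is what makes the initial conditions
   x_(1-k), ..., x_0, y_(1-k), ..., y_0 admissible; division in R is total, so
   it has to be required explicitly. *)
Definition is_solution (R : realType) (k : nat)
    (alpha : R) (beta gamma : nat -> R) (A : R) (B C : nat -> R)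
    (p : R) (delta epsilon : nat -> R) (q : R) (D E : nat -> R)
    (x y : int -> R) : Prop :=
  (forall n : int, 1 - k%:Z <= n <= 0 -> 0 <= x n /\ 0 <= y n) /\
  (forall n : int, 1 <= n ->
     [/\ affine_form k A B C x y n != 0,
         affine_form k q D E x y n != 0,
         x n = affine_form k alpha beta gamma x y n / affine_form k A B C x y n
       & y n = affine_form k p delta epsilon x y n / affine_form k q D E x y n]).

(* Main.v *)
(** Once [n > k] the term [C_j y_(n-j)] keeps the denominator of [x_n] above a
constant, so [1 + x_n <= G * (1 + x_(n-i))], where [i] in [I_beta] maximizes
[x_(n-i)].  Iterating this greedy choice produces indices [n_0 = n, n_1, ...]
whose increments [c_m] lie in [I_beta].  For the block [N1..N2] given by the
hypothesis, [x_(n_(N1-1))] has a numerator at most of order [1 + x_(n_N1)],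
hence of order [1 + x_(n_N2)], and a denominator at least of that order, since
[x_(n_N2)] occurs in it with a positive coefficient.  So [x_(n_(N1-1))] is
bounded, and so is [x_n], which is at most [N1 - 1] steps away. *)

Require Import Defs.
From HB Require Import structures.
From mathcomp Require Import all_boot all_order all_algebra.
From mathcomp Require Import reals.
From mathcomp Require Import zify ring lra.

Set Implicit Arguments.
Unset Strict Implicit.
Unset Printing Implicit Defensive.

Import Order.TTheory GRing.Theory Num.Theory.
Local Open Scope ring_scope.

(** * Boundedness from a block recurrence *)

Lemma backward_argmax (R : realDomainType) (k : nat) (I : pred nat)
    (x : int -> R) (n : int) :
  {subset I <= [pred i | (i <= k)%N]} -> (exists i, i \in I) ->
  exists2 i, i \in I & forall i', i' \in I -> x (n - i'%:Z) <= x (n - i%:Z).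
Proof.
move=> Ik [i0 Ii0].
have ltk i : i \in I -> (i < k.+1)%N by move=> /Ik.
pose f (i : 'I_k.+1) := x (n - (i : nat)%:Z).
have := @Order.TotalTheory.arg_maxP _ _ _ (Ordinal (ltk _ Ii0))
  [pred i : 'I_k.+1 | (i : nat) \in I] f Ii0.
case=> i /= Ii imax; exists i => // i' Ii'.
exact: (imax (Ordinal (ltk _ Ii')) Ii').
Qed.

(** Isolates the combinatorics: [I] and [J] stand for the index sets of [beta] and [B], [e] for a
    lower constant of the denominator, [F] for an upper constant of the numerator. Quantifying over
    upper bounds [w], rather than taking a maximum, also covers an empty [I]. *)
Lemma bounded_of_block_recurrence (R : realFieldType) (k eta : nat)
    (I J : pred nat) (e F : R) (x : int -> R) :
  0 < e -> 0 <= F ->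
  {subset I <= [pred i | (i <= k)%N]} -> {subset J <= [pred j | (0 < j)%N]} ->
  (forall c : nat -> nat, (forall m, (1 <= m)%N -> c m \in I) ->
     exists N1 N2 : nat, [/\ (1 <= N1 <= eta)%N, (1 <= N2 <= eta)%N
       & (\sum_(N1 <= m < N2.+1) c m)%N \in J]) ->
  (forall n : int, 1 <= n -> 0 <= x n) ->
  (forall (n : int) (w : R), k%:Z < n -> 0 <= w ->
     (forall i, i \in I -> x (n - i%:Z) <= w) ->
     e * x n <= F * (1 + w) /\
     forall j, j \in J -> e * (1 + x (n - j%:Z)) * x n <= F * (1 + w)) ->
  forall n : int, (k * eta.+1)%:Z < n ->
    x n <= (1 + F / e) ^+ eta * (1 + F / e * (1 + F / e) ^+ eta).
Proof.
move=> e0 F0 Ik J0 block x0 rec n ltn.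
set H := F / e; set G := 1 + H.
have H0 : 0 <= H by rewrite divr_ge0 // ltW.
have G1 : 1 <= G by rewrite lerDl.
(* For empty [I] the value [w = 0] is admissible and already gives [x n <= H]. *)
have [I0|nI] := boolP [exists i : 'I_k.+1, (i : nat) \in I]; last first.
  have knn : k%:Z < n by nia.
  have /(rec _ _ knn (lexx 0)) [le_xn _] i : i \in I -> x (n - i%:Z) <= 0.
    move=> Ii; case/existsP: nI.
    by exists (Ordinal (Ik _ Ii : (i < k.+1)%N)).
  have xnH : x n <= H by rewrite ler_pdivlMr // mulrC; lra.
  have GE : 1 <= G ^+ eta by rewrite exprn_ege1.
  apply: (@le_trans _ _ (1 * (1 + H * 1))); first lra.
  by apply: ler_pM => //; rewrite ?lerD2l ?ler_wpM2l // mulr1 addr_ge0.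
have {}I0 : exists i, i \in I by case/existsP: I0 => i; exists i.
(* Choosing at every integer makes the backward path infinite, as [block] requires; only its
   positions up to [eta], all above [k], are estimated. *)
have /boolp.choice [pick pickP] (n' : int) : exists i, i \in I /\
    forall i', i' \in I -> x (n' - i'%:Z) <= x (n' - i%:Z).
  by have [i] := backward_argmax x n' Ik I0; exists i.
pose pos m := iter m (fun n' : int => n' - (pick n')%:Z) n.
have posS m : pos m.+1 = pos m - (pick (pos m))%:Z by [].
have pos_ge m : n - (k * m)%:Z <= pos m.
  elim: m => [|m IHm]; first by rewrite muln0 subr0.
  have /Ik := (pickP (pos m)).1; rewrite inE posS mulnS; lia.
have pos_gtk m : (m <= eta)%N -> k%:Z < pos m.
  by move=> mE; have := pos_ge m; have := leq_mul (leqnn k) mE; lia.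
have xpos m : (m <= eta)%N -> 0 <= x (pos m).
  by move=> /pos_gtk ?; apply: x0; lia.
have pos_rec m : (m < eta)%N -> e * x (pos m) <= F * (1 + x (pos m.+1)) /\
    forall j, j \in J ->
      e * (1 + x (pos m - j%:Z)) * x (pos m) <= F * (1 + x (pos m.+1)).
  move=> mE; apply: rec; [exact: pos_gtk (ltnW mE) | exact: xpos |].
  by move=> i Ii; rewrite posS; exact: (pickP _).2.
(* For one step with [u <= H * (1 + v)] and [0 <= v], one gets [1 + u <= G * (1 + v)]. *)
have step s t : (s + t <= eta)%N ->
    1 + x (pos s) <= G ^+ t * (1 + x (pos (s + t)%N)).
  elim: t => [|t IHt]; first by rewrite addn0 expr0 mul1r.
  rewrite addnS => stE; apply: (le_trans (IHt (ltnW stE))).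
  rewrite exprSr -mulrA ler_pM2l ?exprn_gt0 ?(lt_le_trans ltr01) //.
  have [+ _] := pos_rec _ stE; have := xpos _ stE.
  move: (x _) (x _) => u v v0; rewrite mulrC -ler_pdivlMr // /G /H => uv.
  by rewrite mulrDl mul1r mulrAC; lra.
have GX t : (t <= eta)%N -> G ^+ t <= G ^+ eta by move=> ?; rewrite ler_weXn2l.
(* Indexed from 1: [c m] leads from [pos m.-1] to [pos m], so block sums telescope. *)
pose c m := pick (pos m.-1).
have sum_c s t : ((\sum_(s.+1 <= m < (s + t).+1) c m)%N)%:Z = pos s - pos (s + t)%N.
  elim: t => [|t IHt]; first by rewrite addn0 big_geq // subrr.
  by rewrite addnS big_nat_recr ?ltnS ?leq_addr // PoszD IHt posS /c /=; ring.
have cI m : (1 <= m)%N -> c m \in I by move=> _; exact: (pickP _).1.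
have [[|s] [N2 [/andP[s0 sE] /andP[_ N2E] Jsum]]] := block c cI; first by [].
(* An empty block would have sum 0, which is not in [J]. *)
have ltsN2 : (s < N2)%N.
  by rewrite ltnNge; apply/negP => N2s; have := J0 _ Jsum; rewrite big_geq.
have N2def : N2 = (s + (N2 - s))%N by rewrite subnKC // ltnW.
have pos_sub : pos s - ((\sum_(s.+1 <= m < N2.+1) c m)%N)%:Z = pos N2.
  by rewrite N2def sum_c; ring.
have [_ /(_ _ Jsum)] := pos_rec _ sE; rewrite pos_sub => den_s.
have N2def' : N2 = (s.+1 + (N2 - s.+1))%N by rewrite subnKC.
have num_s : 1 + x (pos s.+1) <= G ^+ eta * (1 + x (pos N2)).
  have := step s.+1 (N2 - s.+1)%N; rewrite -N2def' => /(_ N2E) /le_trans; apply.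
  by rewrite ler_wpM2r ?addr_ge0 ?xpos // GX //; lia.
(* The factor [1 + x (pos N2)] bounds both numerator and denominator at [pos s], and cancels. *)
have xs : x (pos s) <= H * G ^+ eta.
  have z1 : 0 < 1 + x (pos N2) by have := xpos _ N2E; lra.
  rewrite /H mulrAC ler_pdivlMr // mulrC -(ler_pM2r z1) mulrAC.
  by apply: (le_trans den_s); rewrite -mulrA ler_wpM2l.
have := step 0%N s; rewrite add0n => /(_ (ltnW sE)) x_le.
apply: (@le_trans _ _ (1 + x n)); first by rewrite lerDr.
apply: (le_trans x_le); apply: ler_pM => //; last by rewrite lerD2l.
- by rewrite exprn_ge0 // (le_trans ler01).
- by rewrite addr_ge0 // xpos // ltnW.
- exact: GX (ltnW sE).
Qed.

(** * Estimates for numerators and denominators *)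

Section AffineForm.
Variables (R : realType) (k : nat) (a : R) (b c : nat -> R) (x y : int -> R).
Hypothesis coef_ge0 : nonneg_coefs k a b c.

Lemma affine_form_ge0 (n : int) :
  (forall m : int, n - k%:Z <= m < n -> 0 <= x m /\ 0 <= y m) ->
  0 <= affine_form k a b c x y n.
Proof.
case: coef_ge0 => a0 bc0 xy0; rewrite /affine_form.
rewrite !addr_ge0 // big_nat sumr_ge0 // => i ik;
  have [b0 c0] := bc0 i ik; have [|? ?] := xy0 (n - i%:Z); try lia;
  exact: mulr_ge0.
Qed.

(** A zero coefficient kills its term, so [x] needs a bound only along the positive indices of
    [b]. *)
Lemma affine_form_le (n : int) (w U : R) :
  0 <= w -> 0 <= U ->
  (forall i, i \in pos_index k b -> x (n - i%:Z) <= w) ->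
  (forall i, (1 <= i <= k)%N -> y (n - i%:Z) <= U) ->
  affine_form k a b c x y n <=
    (a + \sum_(1 <= i < k.+1) b i + U * \sum_(1 <= i < k.+1) c i) * (1 + w).
Proof.
case: coef_ge0 => a0 bc0 w0 U0 xw yU; rewrite /affine_form.
have sb0 : 0 <= \sum_(1 <= i < k.+1) b i.
  by rewrite big_nat sumr_ge0 // => i ik; have [] := bc0 i ik.
have sc0 : 0 <= \sum_(1 <= i < k.+1) c i.
  by rewrite big_nat sumr_ge0 // => i ik; have [] := bc0 i ik.
have sbx : \sum_(1 <= i < k.+1) b i * x (n - i%:Z) <=
    w * \sum_(1 <= i < k.+1) b i.
  rewrite mulr_sumr; apply: ler_sum_nat => i ik; have [b0 _] := bc0 i ik.
  rewrite [leRHS]mulrC; have [bi0|bi0] := ltP 0 (b i).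
    by rewrite ler_pM2l //; apply: xw; rewrite inE /=; apply/andP.
  have -> : b i = 0 by apply/eqP; rewrite eq_le b0 bi0.
  by rewrite !mul0r.
have scy : \sum_(1 <= i < k.+1) c i * y (n - i%:Z) <=
    U * \sum_(1 <= i < k.+1) c i.
  rewrite mulr_sumr; apply: ler_sum_nat => i ik; have [_ c0] := bc0 i ik.
  by rewrite [leRHS]mulrC; apply: ler_wpM2l => //; exact: yU.
have := mulr_ge0 a0 w0; have := mulr_ge0 (mulr_ge0 U0 sc0) w0; nra.
Qed.

Lemma affine_form_ge (n : int) (j : nat) :
  (forall m : int, n - k%:Z <= m < n -> 0 <= x m /\ 0 <= y m) ->
  (1 <= j <= k)%N ->
  c j * y (n - j%:Z) <= affine_form k a b c x y n /\
  forall i, (1 <= i <= k)%N ->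
    c j * y (n - j%:Z) + b i * x (n - i%:Z) <= affine_form k a b c x y n.
Proof.
case: coef_ge0 => a0 bc0 xy0 jk.
have le_sum (f : nat -> R) i : (forall i', (1 <= i' <= k)%N -> 0 <= f i') ->
    (1 <= i <= k)%N -> f i <= \sum_(1 <= i' < k.+1) f i'.
  move=> f0 ik; rewrite big_nat (big_rem i) ?mem_index_iota //=.
  by rewrite ltnS ik lerDl sumr_ge0.
have bx0 i : (1 <= i <= k)%N -> 0 <= b i * x (n - i%:Z).
  move=> ik; have [? _] := bc0 i ik; have [|? _] := xy0 (n - i%:Z); first lia.
  exact: mulr_ge0.
have cy0 i : (1 <= i <= k)%N -> 0 <= c i * y (n - i%:Z).
  move=> ik; have [_ ?] := bc0 i ik; have [|_ ?] := xy0 (n - i%:Z); first lia.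
  exact: mulr_ge0.
have cy := le_sum _ _ cy0 jk; rewrite /affine_form; split.
  have := le_trans (bx0 _ jk) (le_sum _ _ bx0 jk); lra.
by move=> i ik; have := le_sum _ _ bx0 ik; lra.
Qed.

End AffineForm.

(** * Nonnegativity of solutions and the choice of constants *)

Lemma solution_ge0 (R : realType) (k : nat)
    (alpha : R) (beta gamma : nat -> R) (A : R) (B C : nat -> R)
    (p : R) (delta epsilon : nat -> R) (q : R) (D E : nat -> R)
    (x y : int -> R) :
  nonneg_coefs k alpha beta gamma -> nonneg_coefs k A B C ->
  nonneg_coefs k p delta epsilon -> nonneg_coefs k q D E ->
  is_solution k alpha beta gamma A B C p delta epsilon q D E x y ->
  forall n : int, 1 - k%:Z <= n -> 0 <= x n /\ 0 <= y n.
Proof.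
move=> nx dx ny dy [init sol] n.
(* Strong induction on [n + k], which is positive in this range, so the absolute value loses
   nothing. *)
have [m] := ubnP (absz (n + k%:Z)); elim: m => // m IHm in n * => ltm nk.
have [n0|n1] := leP n 0; first by apply: init; rewrite nk n0.
have [_ _ -> ->] := sol n n1.
have prev i : n - k%:Z <= i < n -> 0 <= x i /\ 0 <= y i by move=> ?; apply: IHm; lia.
by split; rewrite divr_ge0 //; exact: affine_form_ge0.
Qed.

(** The cap [d] keeps the minimum meaningful when no [b i] is positive. *)
Lemma pos_family_lower_bound (R : realDomainType) (d : R) (s : seq nat)
    (b : nat -> R) :
  0 < d -> exists e : R, [/\ 0 < e, e <= d
    & forall i, i \in s -> 0 < b i -> e <= b i].
Proof.
move=> d0; elim: s => [|i s [e [e0 ed es]]]; first by exists d.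
have [bi|bi] := ltP 0 (b i); last first.
  exists e; split=> // i'; rewrite inE => /predU1P[->|/es //].
  by rewrite ltNge bi.
exists (Num.min e (b i)); split; first by rewrite lt_min e0.
  by rewrite ge_min ed.
move=> i'; rewrite inE ge_min => /predU1P[-> _|/es h /h ->] //.
by rewrite lexx orbT.
Qed.

Theorem theorem9 (R : realType) (k : nat)
    (alpha : R) (beta gamma : nat -> R) (A : R) (B C : nat -> R)
    (p : R) (delta epsilon : nat -> R) (q : R) (D E : nat -> R)
    (k_gt0 : (0 < k)%N)
    (num_x_ge0 : nonneg_coefs k alpha beta gamma)
    (den_x_ge0 : nonneg_coefs k A B C)
    (num_y_ge0 : nonneg_coefs k p delta epsilon)
    (den_y_ge0 : nonneg_coefs k q D E)
    (y_bounded : exists L U : R, 0 < L /\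
       forall x y : int -> R,
         is_solution k alpha beta gamma A B C p delta epsilon q D E x y ->
         forall n : int, 1 <= n -> L <= y n <= U)
    (IC_neq0 : exists j : nat, j \in pos_index k C)
    (beta_B : exists eta : nat, (0 < eta)%N /\
       forall c : nat -> nat,
         (forall m : nat, (1 <= m)%N -> c m \in pos_index k beta) ->
         exists N1 N2 : nat,
           [/\ (1 <= N1 <= eta)%N, (1 <= N2 <= eta)%N
             & (\sum_(N1 <= m < N2.+1) c m)%N \in pos_index k B]) :
  exists (M : R) (N : nat), [/\ 0 < M, (1 <= N)%N
    & forall x y : int -> R,
        is_solution k alpha beta gamma A B C p delta epsilon q D E x y ->
        forall n : int, N%:Z < n -> x n <= M].
Proof.
have [L [U [L0 yLU]]] := y_bounded.
have [j0 /andP[j0k Cj0]] := IC_neq0.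
have [eta [_ block]] := beta_B.
(* One constant lies below both [C j0 * L] and every positive [B j], so that [e * (1 + x (n - j))]
   bounds the denominator below. *)
have [e [e0 ed eB]] :=
  pos_family_lower_bound (index_iota 1 k.+1) B (mulr_gt0 Cj0 L0).
(* The constants are fixed before any solution is given, so the sign of [U] is not yet known. *)
pose U' := Num.max U 0.
pose F := alpha + \sum_(1 <= i < k.+1) beta i + U' * \sum_(1 <= i < k.+1) gamma i.
have U'0 : 0 <= U' by rewrite le_max lexx orbT.
have F0 : 0 <= F.
  have [a0 bg0] := num_x_ge0.
  rewrite !addr_ge0 ?mulr_ge0 // big_nat sumr_ge0 // => i ik;
    by have [] := bg0 i ik.
have H0 : 0 <= F / e by rewrite divr_ge0 // ltW.
have G0 : 0 < 1 + F / e by rewrite ltr_pwDl.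
exists ((1 + F / e) ^+ eta * (1 + F / e * (1 + F / e) ^+ eta)), (k * eta.+1)%N.
split=> [||x y sol].
- by rewrite mulr_gt0 ?exprn_gt0 // ltr_pwDl // mulr_ge0 // exprn_ge0 // ltW.
- by rewrite muln_gt0 k_gt0.
have xy0 := solution_ge0 num_x_ge0 den_x_ge0 num_y_ge0 den_y_ge0 sol.
have xy1 n : 1 <= n -> 0 <= x n /\ 0 <= y n.
  by move=> n1; apply: xy0; move: n1; clear; lia.
have yb := yLU _ _ sol.
apply: (@bounded_of_block_recurrence _ k eta (pos_index k beta) (pos_index k B)).
- exact: e0.
- exact: F0.
- by move=> i /andP[/andP[]].
- by move=> i /andP[/andP[]].
- exact: block.
- by move=> n /xy1 [].
move=> n w kn w0 xw.
have n1 : 1 <= n by move: kn; clear; lia.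
(* Since [n > k], all delayed indices leave the initial window, where the bounds on [y] are not
   assumed. *)
have back i : (1 <= i <= k)%N -> 1 <= n - i%:Z by move: kn; clear; lia.
have [den0 _ xE _] := sol.2 n n1.
have prev0 m : n - k%:Z <= m < n -> 0 <= x m /\ 0 <= y m by move=> mn; apply: xy1; move: kn mn; clear; lia.
have xn0 : 0 <= x n by have [] := xy1 n n1.
have num_le : affine_form k alpha beta gamma x y n <= F * (1 + w).
  apply: affine_form_le => // i ik; rewrite le_max.
  by have /andP[_ ->] := yb _ (back _ ik).
have xden : affine_form k A B C x y n * x n = affine_form k alpha beta gamma x y n.
  by rewrite xE mulrC divfK.
have [den_ge den_geB] := affine_form_ge den_x_ge0 prev0 j0k.
have Cy : e <= C j0 * y (n - j0%:Z).
  apply: (le_trans ed); rewrite ler_pM2l //.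
  by have /andP[] := yb _ (back _ j0k).
(* Both bounds multiply a lower bound of the denominator by [x n]; the product is at most the
   numerator. *)
split=> [|j /andP[jk Bj]].
  by rewrite (le_trans _ num_le) // -xden ler_wpM2r // (le_trans Cy).
rewrite (le_trans _ num_le) // -xden ler_wpM2r // (le_trans _ (den_geB j jk)) //.
rewrite mulrDr mulr1 lerD // ler_wpM2r //; last by rewrite eB ?mem_index_iota.
by have [] := xy1 _ (back _ jk).
Qed.
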